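(* Let $\mathfrak{C}$ and $\mathfrak{D}$ be full trios such that $\mathfrak{C}$ is not a subclass of $\mathfrak{D}$ (that is, $\mathfrak{C}\not\subseteq\mathfrak{D}$). Then there is a monoid with a cross-section in $\mathfrak{C}$ but no cross-section in $\mathfrak{D}$.
   Context: A full trio (or cone) is a family of languages (each over a finite alphabet), containing at least one non-empty language, that is closed under homomorphism (images under homomorphisms between finitely generated free monoids, possibly erasing letters), inverse homomorphism (preimages under such homomorphisms), and intersection with regular languages. A cross-section for a monoid $M$ is a language $L\subseteq A^*$ over some generating set $A$ for $M$ (elements of $A$ being viewed as letters; here $A$ is finite) such that every element of $M$ is represented by exactly one word in $L$. A monoid has a cross-section in a class of languages if for some finite generating set it has a cross-section that belongs to that class. *)

(* Defs.v *)
From HB Require Import structures.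
From mathcomp Require Import all_boot finmap.
From mathcomp Require Import boolp classical_sets.

Set Implicit Arguments.
Unset Strict Implicit.
Unset Printing Implicit Defensive.

Local Open Scope classical_set_scope.

Definition language (S : finType) := set (seq S).

Definition language_family := forall S : finType, set (language S).

(* The free monoid on [S] is [seq S] with concatenation; letters may be erased. *)
Definition free_monoid_hom (S T : finType) (h : seq S -> seq T) : Prop :=
  h [::] = [::] /\ {morph h : u v / u ++ v}.

Definition regular (S : finType) (L : language S) : Prop :=
  exists (Q : finType) (q0 : Q) (accept : {set Q}) (delta : Q -> S -> Q),
    L = [set w | foldl delta q0 w \in accept].

Record full_trio (F : language_family) : Prop := FullTrio {
  full_trio_nonempty : exists (S : finType) (L : language S), F S L /\ L !=set0;
  full_trio_hom : forall (S T : finType) (h : seq S -> seq T) (L : language S),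
    free_monoid_hom h -> F S L -> F T (h @` L);
  full_trio_invhom : forall (S T : finType) (h : seq S -> seq T) (L : language T),
    free_monoid_hom h -> F T L -> F S (h @^-1` L);
  full_trio_regular : forall (S : finType) (L K : language S),
    F S L -> regular K -> F S (L `&` K)
}.

(* The alphabet [A] is promoted to the finite type of its elements, so that
   letters are elements of the monoid. *)
Definition word_value (M : monoidType) (A : {fset M}) (w : seq A) : M :=
  (\prod_(a <- w) val a)%g.

Definition generates (M : monoidType) (A : {fset M}) : Prop :=
  forall m : M, exists w : seq A, word_value w = m.

Definition cross_section (M : monoidType) (A : {fset M}) (L : language A) : Prop :=
  generates A /\ forall m : M, exists! w : seq A, L w /\ word_value w = m.

Definition has_cross_section_in (F : language_family) (M : monoidType) : Prop :=
  exists (A : {fset M}) (L : language A), cross_section L /\ F A L.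

Definition subfamily (C D : language_family) : Prop :=
  forall S : finType, C S `<=` D S.

(* Main.v *)
(** A factor-closed language [P] gives the Rees quotient of the free monoid by
    the ideal of words outside [P]: its elements are the words of [P] and a
    zero.  From any cross-section one recovers [P] exactly, by deleting the one
    word that represents zero and substituting for every generator its normal
    form.  Given [L] in the first family but not in the second, let [c] be a new
    letter and let [P] consist of the words with at most one [c] together with
    the words [c u c] with [u] in [L]; this is factor-closed.  Up to the word
    [c c c] representing zero, [P] is the union of a regular language with
    [c L c], hence is obtained from [L] by full trio operations; conversely
    [L] is obtained from [P] by full trio operations. *)

Require Import Defs.
From HB Require Import structures.
From mathcomp Require Import all_boot finmap.
From mathcomp Require Import boolp classical_sets zify.

Set Implicit Arguments.
Unset Strict Implicit.
Unset Printing Implicit Defensive.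

Local Open Scope classical_set_scope.

(** * Regular languages, built from automata *)

(** A finite summary [f] that can be updated letter by letter is the run of an automaton starting at
    [f [::]]. *)
Lemma regular_of_state (S Q : finType) (f : seq S -> Q) (delta : Q -> S -> Q)
    (acc : pred Q) :
  (forall w a, f (rcons w a) = delta (f w) a) -> regular [set w | acc (f w)].
Proof.
move=> fE; exists Q, (f [::]), [set q | acc q]%SET, delta.
have foldE w : foldl delta (f [::]) w = f w.
  by elim/last_ind: w => [|w a IH] //; rewrite foldl_rcons IH fE.
by apply/seteqP; split=> w /=; rewrite inE foldE.
Qed.

(** Product automaton. The arbitrary [op] covers union, intersection and, by ignoring an argument,
    complement. *)
Lemma regular_op2 (op : bool -> bool -> bool) (S : finType)
    (p q : pred (seq S)) :
  regular [set w | p w] -> regular [set w | q w] ->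
  regular [set w | op (p w) (q w)].
Proof.
move=> [Q1 [q1 [A1 [d1 E1]]]] [Q2 [q2 [A2 [d2 E2]]]].
have -> : [set w | op (p w) (q w)] =
    [set w | op ((foldl d1 q1 w, foldl d2 q2 w).1 \in A1)
                ((foldl d1 q1 w, foldl d2 q2 w).2 \in A2)].
  have p1 w : p w = (foldl d1 q1 w \in A1).
    by apply/idP/idP; rewrite -/([set v | p v] w) E1.
  have p2 w : q w = (foldl d2 q2 w \in A2).
    by apply/idP/idP; rewrite -/([set v | q v] w) E2.
  by apply/seteqP; split=> w /=; rewrite p1 p2.
pose acc (x : Q1 * Q2) := op (x.1 \in A1) (x.2 \in A2).
apply: (@regular_of_state _ _ (fun w => (foldl d1 q1 w, foldl d2 q2 w))
  (fun x a => (d1 x.1 a, d2 x.2 a)) acc) => w a.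
by rewrite !foldl_rcons.
Qed.

Lemma regular_neg (S : finType) (p : pred (seq S)) :
  regular [set w | p w] -> regular [set w | ~~ p w].
Proof. by move=> rp; apply: (@regular_op2 (fun b _ => ~~ b) _ p p). Qed.

Lemma regular_preimage (S T : finType) (h : seq S -> seq T) (p : pred (seq T)) :
  free_monoid_hom h -> regular [set w | p w] -> regular [set w | p (h w)].
Proof.
move=> [_ hD] [Q [q0 [A [d E]]]].
have -> : [set w | p (h w)] = [set w | foldl d q0 (h w) \in A].
  have pE w : p w = (foldl d q0 w \in A).
    by apply/idP/idP; rewrite -/([set v | p v] w) E.
  by apply/seteqP; split=> w /=; rewrite pE.
(* Reading one letter [a] drives the automaton along the whole word [h [:: a]]. *)
apply: (@regular_of_state _ _ (fun w => foldl d q0 (h w))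
  (fun q a => foldl d q (h [:: a])) (mem A)) => w a.
by rewrite -cats1 hD foldl_cat.
Qed.

Lemma regular_all (S : finType) (a : pred S) : regular [set w | all a w].
Proof.
apply: (@regular_of_state _ _ (all a) (fun b x => b && a x) id) => w x.
by rewrite all_rcons andbC.
Qed.

Lemma regular_ohead (S : finType) (x : S) :
  regular [set w : seq S | ohead w == Some x].
Proof.
by apply: (@regular_of_state _ _ ohead
  (fun o a => if o is Some b then Some b else Some a) (pred1 (Some x))); case.
Qed.

Lemma regular_last (S : finType) (x : S) :
  regular [set w : seq S | last x w == x].
Proof.
apply: (@regular_of_state _ _ (last x) (fun _ a => a) (pred1 x)) => w a.
exact: last_rcons.
Qed.

Lemma regular_count (S : finType) (a : pred S) (k : nat) :
  regular [set w | count a w == k].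
Proof.
(* Capping the count at [k.+1], which stands for more than [k], leaves finitely many states. *)
pose f w : 'I_k.+2 := inord (minn k.+1 (count a w)).
have fE w : f w = minn k.+1 (count a w) :> nat.
  by rewrite inordK // ltnS geq_minl.
have -> : [set w | count a w == k] = [set w | (f w == k :> nat)].
  by apply/seteqP; split=> w /=; rewrite fE; [move/eqP->|]; lia.
apply: (@regular_of_state _ _ f (fun q x => inord (minn k.+1 (q + a x)))
  (fun q => q == k :> nat)) => w x.
apply/val_inj; rewrite /= !fE inordK ?ltnS ?geq_minl //.
rewrite -cats1 count_cat /= addn0; lia.
Qed.

Lemma regular_set1 (S : finType) (v : seq S) : regular [set w | w == v].
Proof.
(* The state is the length of the prefix of [v] read so far, or [None] once the input has left
   [v]. *)
pose f w : option 'I_(size v).+1 :=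
  if prefix w v then Some (inord (size w)) else None.
have -> : [set w | w == v] = [set w | f w == Some ord_max].
  apply/seteqP; split=> w /=; rewrite /f.
    move/eqP->; rewrite prefix_refl; apply/eqP/congr1/val_inj.
    by rewrite /= inordK.
  case: ifP => // /prefixP[u vE] /eqP[/(congr1 val)] /=.
  rewrite inordK ?ltnS ?size_prefix //; last by rewrite vE prefix_prefix.
  move/eqP; rewrite vE size_cat -{1}[size w]addn0 eqn_add2l eq_sym size_eq0.
  by move/eqP->; rewrite cats0.
pose delta (q : option 'I_(size v).+1) a : option 'I_(size v).+1 :=
  if q is Some i then f (rcons (take i v) a) else None.
apply: (@regular_of_state _ _ f delta (pred1 (Some ord_max))) => w a.
rewrite {2}/f; case: ifP => [wv|wv] /=.
  by rewrite inordK ?ltnS ?size_prefix //; move: wv; rewrite prefixE => /eqP->.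
rewrite /f ifN //; apply/negP => /prefixP[u vE].
by move/negP: wv; apply; apply/prefixP; exists (a :: u); rewrite vE cat_rcons.
Qed.

(** * Homomorphisms and closure properties of full trios *)

Lemma free_monoid_hom_pmap (S T : finType) (f : S -> option T) :
  free_monoid_hom (pmap f).
Proof. by split=> // u v; rewrite pmap_cat. Qed.

Lemma free_monoid_hom_flatten (S T : finType) (f : S -> seq T) :
  free_monoid_hom (fun w => flatten (map f w)).
Proof. by split=> // u v; rewrite map_cat flatten_cat. Qed.

Lemma free_monoid_hom_map (S T : finType) (f : S -> T) :
  free_monoid_hom (map f).
Proof. by split=> // u v; rewrite map_cat. Qed.

(** Any member of the family can be cut down to the empty language, then carried to the alphabet [S]
    by the homomorphism erasing everything. *)
Lemma full_trio_set0 (F : language_family) (S : finType) :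
  full_trio F -> F S set0.
Proof.
move=> [[T [K [FK _]]] Fhom _ Freg].
have r0 : regular [set w : seq T | false].
  exact: (@regular_of_state _ _ (fun=> tt) (fun _ _ => tt) xpred0).
have := Fhom _ S _ _ (free_monoid_hom_pmap (fun=> None)) (Freg _ _ _ FK r0).
by congr (F S _); apply/seteqP; split=> w // [v [_]].
Qed.

Lemma full_trio_setU_regular (F : language_family) (T : finType)
    (L : language T) (r : pred (seq T)) :
  full_trio F -> F T L -> L !=set0 -> regular [set w | r w] ->
  F T (L `|` [set w | r w]).
Proof.
move=> [_ Fhom Finv Freg] FL [u0 Lu0] rr.
(* A word over three copies of [T]: the first copy is kept, the second is read
   as part of a word of [L] but erased, the third is output without being read.
   A word of [r] is produced by erasing some fixed word of [L]. *)
pose in_letter (x : T + (T + T)) : option T :=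
  match x with inl t => Some t | inr (inl t) => Some t | _ => None end.
pose out_letter (x : T + (T + T)) : option T :=
  match x with inl t => Some t | inr (inl t) => None | inr (inr t) => Some t end.
pose kept (x : T + (T + T)) := if x is inl _ then true else false.
pose K w := all kept w || (all (predC kept) w && r (pmap out_letter w)).
have rK : regular [set w | K w].
  apply: (@regular_op2 orb _ (all kept)
    (fun w => all (predC kept) w && r (pmap out_letter w))).
    exact: regular_all.
  apply: (@regular_op2 andb _ (all (predC kept))
    (fun w => r (pmap out_letter w))); first exact: regular_all.
  exact: regular_preimage (free_monoid_hom_pmap _) rr.
have := Fhom _ _ _ _ (free_monoid_hom_pmap out_letter)
  (Freg _ _ _ (Finv _ _ _ _ (free_monoid_hom_pmap in_letter) FL) rK).
congr (F T _); apply/seteqP; split=> w /=.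
  move=> [v [Lv /orP[kv|/andP[_ rv]]] <-]; [left|by right].
  suff -> : pmap out_letter v = pmap in_letter v by [].
  by elim: v kv {Lv} => [|[t|t] v IH] //= /IH ->.
move=> [Lw|rw].
  exists (map inl w); first split=> /=.
  - by rewrite map_pK.
  - by rewrite /K all_map all_predT.
  - by rewrite map_pK.
have read0 v : pmap in_letter (map (inr \o inr) v) = [::] by elim: v.
have erased v : pmap out_letter (map (inr \o inl) v) = [::] by elim: v.
exists (map (inr \o inl) u0 ++ map (inr \o inr) w).
  split=> /=; first by rewrite pmap_cat read0 map_pK // cats0.
  apply/orP; right; rewrite pmap_cat erased map_pK //= rw andbT all_cat !all_map.
  by apply/andP; split; apply/allP.
by rewrite pmap_cat erased map_pK.
Qed.

(** * The Rees quotient monoid *)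

Record factorial_language (S : Type) := FactorialLanguage {
  factorial_pred :> pred (seq S);
  factorial_nil : factorial_pred [::];
  factorial_factor : forall u v w,
    factorial_pred (u ++ v ++ w) -> factorial_pred v
}.

(* [None] is the zero of the Rees quotient. *)
Definition rees_quotient (S : choiceType) (P : factorial_language S) :=
  option {w : seq S | P w}.

Section ReesQuotient.
Variables (S : choiceType) (P : factorial_language S).
Implicit Types (x y z : rees_quotient P) (u v w : seq S).

HB.instance Definition _ := Choice.on (rees_quotient P).

Definition rees_class w : rees_quotient P := insub w.

Definition rees_mul x y : rees_quotient P :=
  match x, y with
  | Some u, Some v => rees_class (val u ++ val v)
  | _, _ => None
  end.

Lemma rees_class_val (u : {w : seq S | P w}) : rees_class (val u) = Some u.
Proof. exact: valK. Qed.

Lemma rees_class_val_eq w (u : {w : seq S | P w}) :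
  rees_class w = Some u -> val u = w.
Proof. by rewrite /rees_class; case: insubP => // v _ <- [->]. Qed.

(** If [u] or [v] lies outside [P], then so does [u ++ v] by factor-closure, and both sides are
    zero. The monoid laws are thereby inherited from concatenation. *)
Lemma rees_class_cat u v :
  rees_mul (rees_class u) (rees_class v) = rees_class (u ++ v).
Proof.
rewrite /rees_class; case: insubP => [u' _ <-|nPu] /=; last first.
  by rewrite insubN //; apply: contra nPu; apply: (@factorial_factor _ P [::]).
case: insubP => [v' _ <-|nPv] //=.
rewrite insubN //; apply: contra nPv => Puv.
by apply: (@factorial_factor _ P (val u') _ [::]); rewrite cats0.
Qed.

Lemma rees_mulA : associative rees_mul.
Proof.
move=> [u|] [v|] [w|] //; last by rewrite /rees_mul; case: rees_class.
by rewrite -!rees_class_val !rees_class_cat catA.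
Qed.

Lemma rees_mul1 : left_id (rees_class [::]) rees_mul.
Proof.
move=> [u|]; first by rewrite -(rees_class_val u) rees_class_cat.
by rewrite /rees_mul; case: rees_class.
Qed.

Lemma rees_mulr1 : right_id (rees_class [::]) rees_mul.
Proof.
by move=> [u|] //; rewrite -(rees_class_val u) rees_class_cat cats0.
Qed.

HB.instance Definition _ :=
  isMonoid.Build (rees_quotient P) rees_mulA rees_mul1 rees_mulr1.

End ReesQuotient.

(** * Cross-sections of the Rees quotient *)

Lemma word_value_nil (M : monoidType) (A : {fset M}) :
  word_value ([::] : seq A) = 1%g.
Proof. exact: big_nil. Qed.

Lemma word_value_cons (M : monoidType) (A : {fset M}) (a : A) w :
  word_value (a :: w) = (val a * word_value w)%g.
Proof. exact: big_cons. Qed.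

(** Words of [P] are normal forms of the nonzero elements; [z] is the chosen representative of
    zero. *)
Lemma rees_cross_section (F : language_family) (S : finType)
    (P : factorial_language S) (z : seq S) :
  full_trio F -> ~~ P z -> F S [set w | P w || (w == z)] ->
  has_cross_section_in F (rees_quotient P).
Proof.
move=> tF nPz FPz.
pose A := [fset rees_class P [:: s] | s in S]%fset.
have inA s : rees_class P [:: s] \in A by apply: in_imfset.
pose g s : A := [` inA s]%fset.
have gE w : word_value (map g w) = rees_class P w.
  elim: w => [|s w IH]; first by rewrite word_value_nil.
  by rewrite /= word_value_cons IH; apply: rees_class_cat.
have ex x : exists2 w, P w || (w == z) & rees_class P w = x.
  case: x => [u|]; first by exists (val u); rewrite ?rees_class_val // (valP u).
  by exists z; rewrite ?eqxx ?orbT // /rees_class insubN.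
exists A, (map g @` [set w | P w || (w == z)]); split; last first.
  exact: full_trio_hom tF _ _ _ _ (free_monoid_hom_map g) FPz.
split=> [x|x]; first by have [w _ <-] := ex x; exists (map g w).
have [w Pw wx] := ex x.
exists (map g w); split; first by split; [exists w|rewrite gE].
(* The map [g] may identify letters outside [P], but on the chosen words equal classes already force
   equal words. *)
move=> _ [[v Pv <-]]; rewrite gE -wx => vw; congr map.
move: Pw Pv vw => /orP[Pw|/eqP->] /= /orP[Pv|/eqP->]; rewrite /rees_class.
- by rewrite !insubT => -[].
- by rewrite insubN // insubT.
- by rewrite insubT insubN.
- by [].
Qed.

Lemma rees_cross_section_inv (F : language_family) (S : finType)
    (P : factorial_language S) :
  full_trio F -> has_cross_section_in F (rees_quotient P) -> F S [set w | P w].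
Proof.
move=> [_ Fhom _ Freg] [A [K [[_ KP] FK]]].
have [k0 [[Kk0 k0E] k0U]] := KP (None : rees_quotient P).
(* The empty word assigned to a zero generator is harmless: no such letter occurs in a word of
   nonzero value. *)
pose h (a : A) : seq S := if val a is Some u then val u else [::].
(* A nonzero product is the plain concatenation of the normal forms of its factors. *)
have hE w u : word_value w = Some u :> rees_quotient P ->
    flatten (map h w) = val u.
  elim: w u => [|a w IH] u /=.
    by rewrite word_value_nil => /rees_class_val_eq ->.
  rewrite word_value_cons /h; case: (val a) => [v|//].
  case: (word_value w) IH => [t|//] IH /rees_class_val_eq ->.
  by rewrite (IH t).
have := Fhom _ _ _ _ (free_monoid_hom_flatten h)
  (Freg _ _ _ FK (regular_neg (regular_set1 k0))).
congr (F S _); apply/seteqP; split=> w /=.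
  move=> [k [Kk kk0] <-].
  case E: (word_value k : rees_quotient P) => [u|].
    by rewrite (hE _ _ E) (valP u).
  by rewrite (k0U k) ?eqxx in kk0.
move=> Pw; have [k [[Kk kE] _]] := KP (rees_class P w).
have wE : rees_class P w = Some (exist _ w Pw) by exact: insubT.
rewrite wE in kE.
exists k; last exact: hE kE.
by split=> //; apply/eqP => kk0; rewrite kk0 k0E in kE.
Qed.

(** * Encoding a language by end markers *)

Section MarkedLanguage.
Variables (S : finType) (L : language S).

Definition markers (w : seq (option S)) := count (pred1 None) w.

Lemma markers_cat u v : markers (u ++ v) = markers u + markers v.
Proof. exact: count_cat. Qed.

(** With [None] as the marker c, these are the words c u c with [u] free of c. The count keeps the
    two ends distinct, and the empty word, which passes the [last] test by default, is excluded. *)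
Definition two_markers (w : seq (option S)) :=
  [&& ohead w == Some None, last None w == None & markers w == 2].

Definition marked_factor (w : seq (option S)) :=
  (markers w <= 1) || (two_markers w && `[< L (pmap id w) >]).

(** A factor with at most one marker is accepted outright. One with two contains both ends of the
    word, hence is the whole word. *)
Lemma marked_factor_factor u v w :
  marked_factor (u ++ v ++ w) -> marked_factor v.
Proof.
rewrite /marked_factor.
have [//|/= cv] := leqP (markers v) 1.
rewrite {1}/two_markers !markers_cat => /orP[|/andP[/and3P[hd lst c2] Lv]].
  by lia.
have [mu mw] : markers u = 0 /\ markers w = 0 by lia.
have u0 : u = [::] by case: u hd mu {c2 lst Lv} => //= a u /eqP[->].
have w0 : w = [::].
  case/lastP: w lst mw {c2 hd Lv} => // w a.
  rewrite catA last_cat last_rcons -cats1 markers_cat => /eqP->.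
  by rewrite /markers /=; lia.
move: hd lst c2 Lv; rewrite u0 w0 /= cats0 => hd lst c2 ->.
by rewrite /two_markers hd lst andbT /=; lia.
Qed.

Definition marked : factorial_language (option S) :=
  @FactorialLanguage _ marked_factor isT marked_factor_factor.

Lemma regular_two_markers : regular [set w | two_markers w].
Proof.
apply: (@regular_op2 andb _ (fun w => ohead w == Some None)
  (fun w => (last None w == None) && (markers w == 2))).
  exact: regular_ohead.
apply: (@regular_op2 andb _ (fun w => last None w == None)
  (fun w => markers w == 2)); first exact: regular_last.
exact: regular_count.
Qed.

Lemma mark_word (u : seq S) :
  two_markers (None :: rcons (map Some u) None) /\
  pmap id (None :: rcons (map Some u) None) = u.
Proof.
split; last by rewrite /= -cats1 pmap_cat (@map_pK _ _ id Some) // cats0.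
rewrite /two_markers /markers /= last_rcons -cats1 count_cat count_map /=.
by rewrite (@eq_count _ _ pred0) ?count_pred0.
Qed.

Lemma marked_full_trio (F : language_family) : full_trio F ->
  F S L -> L !=set0 ->
  F (option S) [set w | marked w || (w == nseq 3 None)].
Proof.
move=> tF FL [u Lu].
(* The regular part: everything except c L c, which is cut out by [two_markers] from the preimage of
   [L] under marker erasure. *)
pose r w := [|| markers w == 0, markers w == 1
  | w == nseq 3 (None : option S)].
have rr : regular [set w | r w].
  apply: (@regular_op2 orb _ (fun w => markers w == 0)
   (fun w => (markers w == 1) || (w == nseq 3 (None : option S)))).
    exact: regular_count.
  apply: (@regular_op2 orb _ (fun w => markers w == 1)
   (fun w => w == nseq 3 (None : option S))); first exact: regular_count.
  exact: regular_set1.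
have := full_trio_setU_regular tF (full_trio_regular tF
  (full_trio_invhom tF (free_monoid_hom_pmap id) FL) regular_two_markers) _ rr.
have -> : (@pmap (option S) S id @^-1` L) `&` [set w | two_markers w] `|`
    [set w | r w] = [set w | marked w || (w == nseq 3 None)].
  apply/seteqP; split=> w /=; rewrite /marked_factor.
    move=> [[/= Lw tw]|/or3P[/eqP->|/eqP->|->]]; rewrite ?orbT //.
    by rewrite tw (asboolT Lw) !orbT.
  case/orP => [/orP[|/andP[tw /asboolP]]|zw].
  - by right; rewrite /r orbA -leqn0 /=; lia.
  - by left.
  - by right; rewrite /r zw !orbT.
apply; exists (None :: rcons (map Some u) None).
have [tu uE] := mark_word u; split=> //=.
by rewrite -[pmap _ _]/(pmap id (None :: _)) uE.
Qed.

(** Intersecting with [two_markers] leaves c L c, and erasing the markers leaves [L]. *)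
Lemma marked_full_trio_inv (F : language_family) : full_trio F ->
  F (option S) [set w | marked w] -> F S L.
Proof.
move=> tF FP.
have := full_trio_hom tF (free_monoid_hom_pmap id)
  (full_trio_regular tF FP regular_two_markers).
congr (F S _); apply/seteqP; split=> u /=.
  move=> [w [+ tw] <-]; rewrite /marked_factor; case: (and3P tw) => _ _ /eqP->.
  by case/andP=> _ /asboolP.
move=> Lu; have [tu uE] := mark_word u.
exists (None :: rcons (map Some u) None); last by [].
by split=> //=; rewrite /marked_factor tu uE (asboolT Lu) orbT.
Qed.

End MarkedLanguage.

Theorem theorem4p1 (C D : language_family) (hC : full_trio C)
    (hD : full_trio D) (hCD : ~ subfamily C D) :
  exists M : monoidType,
    has_cross_section_in C M /\ ~ has_cross_section_in D M.
Proof.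
move: hCD => /existsNP[S] /existsNP[L] /not_implyP[CL nDL].
exists (rees_quotient (marked L)); split.
  apply: (rees_cross_section hC _ (marked_full_trio hC CL _)).
    by [].
  (* [L] is non-empty, since the empty language belongs to [D]. *)
  apply/set0P/eqP => L0; apply: nDL; rewrite L0; exact: full_trio_set0.
by move=> /(rees_cross_section_inv hD) /(marked_full_trio_inv hD).
Qed.
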